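(* Let $m,n,s,t$ be positive integers with $s\geq 2$ and $t\geq 2$. Then for every integer $k\in\{0,1,\ldots,s-2\}$, $$z(m,n,s,t)\leq (s-k-1)^{1/t}\,n\,m^{1-1/t}+(t-1)\,m^{1+k/t}+kn.$$
   Context: For positive integers $s,t$, $J_{s,t}$ denotes the all-ones matrix with $s$ rows and $t$ columns. For positive integers $m,n,s,t$, $z(m,n,s,t)$ denotes the maximum number of ones in a $(0,1)$-matrix of size $m\times n$ ($m$ rows, $n$ columns) that does not contain $J_{s,t}$ as a submatrix. Here a submatrix is obtained by selecting any $s$ distinct rows and any $t$ distinct columns, not necessarily consecutive. *)

(* Defs.v *)
From mathcomp Require Import all_boot all_order all_algebra.
From mathcomp Require Import all_classical all_reals all_analysis.

Set Implicit Arguments.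
Unset Strict Implicit.
Unset Printing Implicit Defensive.

Import Order.TTheory GRing.Theory Num.Theory.

Local Open Scope nat_scope.

(* A (0,1)-matrix is an element of 'M[bool]_(m, n), with 1 encoded as true. *)
Definition all_ones (s t : nat) : 'M[bool]_(s, t) := const_mx true.

Definition num_ones (m n : nat) (A : 'M[bool]_(m, n)) : nat :=
  #|[set ij : 'I_m * 'I_n | A ij.1 ij.2]|.

(* The selected rows (columns) are distinct but may be listed in any order;
   this is immaterial when looking for an all-ones submatrix, which is
   invariant under permutations of its rows and columns. *)
Definition has_submx (m n s t : nat) (A : 'M[bool]_(m, n))
    (B : 'M[bool]_(s, t)) : bool :=
  [exists f : {ffun 'I_s -> 'I_m}, exists g : {ffun 'I_t -> 'I_n},
    [&& injectiveb f, injectiveb g & mxsub f g A == B]].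

(* For 0 < s and 0 < t the zero matrix is admissible, so this is a genuine
   maximum and the default value 0 of \max is never used. *)
Definition zarankiewicz (m n s t : nat) : nat :=
  \max_(A : 'M[bool]_(m, n) | ~~ has_submx A (all_ones s t)) num_ones A.

(* Main.v *)
Require Import Defs.
From mathcomp Require Import all_boot all_order all_algebra.
From mathcomp Require Import all_classical all_reals all_analysis.
From mathcomp Require Import zify ring lra.

Import Order.TTheory GRing.Theory Num.Theory.
Local Open Scope ring_scope.

(** The idea is to apply the Kovari-Sos-Turan argument not to the matrix itself
    but to many of its submatrices, and to average the results.

    Let [A] have no all-ones [s x t] submatrix. Fix a set [K] of [k] rows and
    let [C_K] be the set of columns that are full of ones on [K]. The submatrix
    on the rows outside [K] and the columns in [C_K] has no all-ones
    [(s - k) x t] submatrix, since the rows of [K] could be added to it. The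
    Kovari-Sos-Turan bound (lemmas [kovari_sos_turan] and [kst_common_cols])
    then says that this submatrix has at most [a * #|C_K| + (t - 1) * m] ones,
    where [a = (s - k - 1)^(1/t) * m^(1 - 1/t)].

    Sum this over all [K]. A column with [d] ones belongs to ['C(d, k)] of the
    sets [C_K] and has [d - k] ones outside each such [K], so
      [\sum_j 'C(d_j, k) * (d_j - k - a) <= (t - 1) * m * 'C(m, k)].
    The weight ['C(d, k)] is nondecreasing in [d], and the other factor changes
    sign at [d = k + a]; so, up to the common factor [k!], the weight may be
    replaced by its value there, [P = (a + 1) ... (a + k)] (lemma
    [ffact_tangent]). This gives [P * \sum_j (d_j - k - a) <= (t - 1) * m^(k+1)]
    (lemma [ones_above_threshold]). Finally [k <= s - 2] makes [s - k - 1] at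
    least [1], whence [P >= a^k >= m^(k - k/t)], and dividing by [P] leaves
    [(t - 1) * m^(1 + k/t)] on the right. *)

(** * The power mean inequality for natural numbers *)

(** The difference of the two sides is [(x - y) * (x ^ t - y ^ t)], a product
    of two factors of the same sign. *)
Lemma chebyshev_pow (x y t : nat) :
  (x * y ^ t + y * x ^ t <= x * x ^ t + y * y ^ t)%N.
Proof.
wlog le_xy : x y / (x <= y)%N.
  by move=> H; case/orP: (leq_total x y) => /H //; lia.
have : (x ^ t <= y ^ t)%N by case: t => // t; rewrite leq_exp2r.
by nia.
Qed.

(** Summing [chebyshev_pow] over all ordered pairs of indices gives twice this
    inequality. *)
Lemma chebyshev_sum (I : finType) (X : {set I}) (x : I -> nat) (t : nat) :
  ((\sum_(i in X) x i) * (\sum_(i in X) x i ^ t)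
    <= #|X| * \sum_(i in X) x i ^ t.+1)%N.
Proof.
have E (f g : I -> nat) : ((\sum_(i in X) f i) * (\sum_(i in X) g i) =
    \sum_(i in X) \sum_(j in X) f i * g j)%N.
  by rewrite big_distrl; apply: eq_bigr => i _; rewrite big_distrr.
rewrite -(leq_pmul2l (isT : 0 < 2)%N) !mul2n -!addnn.
rewrite -sum1_card !E {2}exchange_big [X in (_ <= _ + X)%N]exchange_big.
rewrite -!big_split /=; apply: leq_sum => i _.
rewrite -!big_split /=; apply: leq_sum => j _.
by have := chebyshev_pow (x i) (x j) t; rewrite !expnS; lia.
Qed.

Lemma power_mean (I : finType) (X : {set I}) (x : I -> nat) (t : nat) :
  ((\sum_(i in X) x i) ^ t.+1 <= #|X| ^ t * \sum_(i in X) x i ^ t.+1)%N.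
Proof.
elim: t => [|t IH]; first by rewrite mul1n expn1.
rewrite expnS (leq_trans (leq_mul (leqnn _) IH)) //.
rewrite mulnCA expnSr -mulnA leq_mul2l; apply/orP; right.
exact: chebyshev_sum.
Qed.

(** * The Kovari-Sos-Turan counting argument *)

Lemma ffact_le_exp (n t : nat) : (n ^_ t <= n ^ t)%N.
Proof.
rewrite ffact_prod -[X in (_ <= n ^ X)%N]card_ord -prod_nat_const.
by apply: leq_prod => i _; rewrite leq_subr.
Qed.

Lemma exp_le_ffact (n t : nat) : ((n - t) ^ t.+1 <= n ^_ t.+1)%N.
Proof.
rewrite ffact_prod -[X in (_ ^ X <= _)%N]card_ord -prod_nat_const.
by apply: leq_prod => i _; rewrite leq_sub2l // -ltnS.
Qed.

(** Count the pairs [(i, T)] where [T] is a set of [t.+1] elements of [F i]: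
    each [T] is contained in [Y] and occurs at most [c] times, so the sum of
    the ['C(#|F i|, t.+1)] is at most [c * 'C(#|Y|, t.+1)]. The power mean
    inequality turns this into a bound on the sum of the sizes. Truncated
    subtraction of [t] keeps everything in the natural numbers, because
    [(#|F i| - t) ^ t.+1] is below the falling factorial even when
    [#|F i| < t]. *)
Lemma kovari_sos_turan (I J : finType) (X : {set I}) (Y : {set J})
    (F : I -> {set J}) (c t : nat) :
    (forall i, i \in X -> F i \subset Y) ->
    (forall T : {set J}, T \subset Y -> #|T| = t.+1 ->
       (#|[set i in X | T \subset F i]| <= c)%N) ->
  ((\sum_(i in X) (#|F i| - t)) ^ t.+1 <= #|X| ^ t * (c * #|Y| ^ t.+1))%N.
Proof.
move=> FY few; apply: leq_trans (power_mean _ _ _ _) _.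
rewrite leq_mul2l; apply/orP; right.
have count : (\sum_(i in X) 'C(#|F i|, t.+1) <= c * 'C(#|Y|, t.+1))%N.
  under eq_bigr => i _ do rewrite -cards_draws -sum1dep_card.
  rewrite -cards_draws -sum1dep_card.
  rewrite (exchange_big_dep
    (fun T : {set J} => (T \subset Y) && (#|T| == t.+1))) /=; last first.
    by move=> i T Xi /andP[TF ->]; rewrite (fintype.subset_trans TF (FY i Xi)).
  rewrite big_distrr /=; apply: leq_sum => T /andP[TY /eqP cT].
  rewrite muln1 (leq_trans _ (few T TY cT)) // -sum1dep_card leq_eqVlt.
  by apply/orP; left; apply/eqP/eq_bigl => i; rewrite cT eqxx andbT.
apply: (@leq_trans (\sum_(i in X) #|F i| ^_ t.+1)%N).
  by apply: leq_sum => i _; exact: exp_le_ffact.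
under eq_bigr => i _ do rewrite -bin_ffact.
rewrite -big_distrl /= (leq_trans (leq_mul count (leqnn _))) //.
by rewrite -mulnA bin_ffact leq_mul2l ffact_le_exp orbT.
Qed.

Lemma all_ones_submx (m n s t : nat) (A : 'M[bool]_(m, n))
    (S : {set 'I_m}) (T : {set 'I_n}) :
    (s <= #|S|)%N -> (t <= #|T|)%N ->
    (forall i j, i \in S -> j \in T -> A i j) ->
  has_submx A (all_ones s t).
Proof.
move=> sS tT AST.
pose f := [ffun a : 'I_s => enum_val (widen_ord sS a)].
pose g := [ffun b : 'I_t => enum_val (widen_ord tT b)].
apply/existsP; exists f; apply/existsP; exists g; apply/and3P; split.
- by apply/injectiveP => a b; rewrite !ffunE => /enum_val_inj [] /val_inj.
- by apply/injectiveP => a b; rewrite !ffunE => /enum_val_inj [] /val_inj.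
- apply/eqP/matrixP => a b; rewrite !mxE !ffunE.
  by apply: AST; exact: enum_valP.
Qed.

(** * Rows outside a set K and the columns that are full on K *)

Section Incidence.
Context {m n : nat} (A : 'M[bool]_(m, n)).

Definition row_supp (i : 'I_m) : {set 'I_n} := [set j | A i j].
Definition col_supp (j : 'I_n) : {set 'I_m} := [set i | A i j].
Definition common_cols (K : {set 'I_m}) : {set 'I_n} :=
  [set j | K \subset col_supp j].

Lemma num_onesE : num_ones A = (\sum_j #|col_supp j|)%N.
Proof.
rewrite /num_ones -sum1dep_card.
rewrite -(pair_big_dep xpredT (fun i j => A i j) (fun _ _ => 1%N)) /=.
rewrite (exchange_big_dep xpredT) //=; apply: eq_bigr => j _.
by rewrite -sum1dep_card.
Qed.

(** If [s - #|K|] rows outside [K] were full on a set [T] of [t.+1] common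
    columns of [K], then together with [K] they would be [s] rows that are full
    on [T]. *)
Lemma kst_common_cols (s t : nat) (K : {set 'I_m}) :
    ~~ has_submx A (all_ones s t.+1) -> (#|K| < s)%N ->
  ((\sum_(i in ~: K) (#|row_supp i :&: common_cols K| - t)) ^ t.+1
    <= m ^ t * ((s - #|K|).-1 * #|common_cols K| ^ t.+1))%N.
Proof.
move=> noJ Ks.
apply: leq_trans (@kovari_sos_turan _ _ (~: K) (common_cols K)
   (fun i => row_supp i :&: common_cols K) (s - #|K|).-1 t _ _) _.
- by move=> i _; exact: finset.subsetIr.
- move=> T TK cT; rewrite leqNgt; apply: contra noJ => big.
  set S := [set i in ~: K | T \subset row_supp i :&: common_cols K] in big.
  apply: (@all_ones_submx _ _ _ _ _ (K :|: S) T); last 2 first.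
  + by rewrite cT.
  + move=> i j + Tj; rewrite inE => /orP[iK|].
      move: (fintype.subsetP TK _ Tj); rewrite inE.
      by move=> /fintype.subsetP/(_ _ iK); rewrite inE.
    rewrite inE => /andP[_ /fintype.subsetP/(_ _ Tj)].
    by rewrite !inE => /andP[].
  have disj : K :&: S = finset.set0.
    by apply/finset.setP => i; rewrite !inE; case: (i \in K).
  by rewrite cardsU disj cards0; lia.
- rewrite leq_mul2r; apply/orP; right.
  have : (#|~: K| <= m)%N by rewrite -[X in (_ <= X)%N]card_ord max_card.
  by case: t {noJ} => // t; rewrite leq_exp2r.
Qed.

(** Both sides count the ones in rows outside [K] and columns that are full on
    [K], by rows and by columns. *)
Lemma ones_common_cols (K : {set 'I_m}) :
  (\sum_(i in ~: K) #|row_supp i :&: common_cols K|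
    = \sum_(j in common_cols K) (#|col_supp j| - #|K|))%N.
Proof.
under eq_bigr => i _ do rewrite -sum1_card.
rewrite (exchange_big_dep (fun j => j \in common_cols K)) /=; last first.
  by move=> i j _; rewrite inE => /andP[].
apply: eq_bigr => j jK; rewrite sum1dep_card.
have Kj : K \subset col_supp j by move: jK; rewrite inE.
rewrite -(cardsID K (col_supp j)) (finset.setIidPr Kj) addKn.
by apply: eq_card => i; rewrite !inE in jK *; rewrite jK andbT.
Qed.

(** Exchange the two sums: the column [j] is counted once for each [k]-subset of
    its support. *)
Lemma sum_common_cols (V : nmodType) (k : nat) (g : 'I_n -> V) :
  \sum_(K : {set 'I_m} | #|K| == k) \sum_(j in common_cols K) g j
    = \sum_j g j *+ 'C(#|col_supp j|, k).
Proof.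
rewrite (exchange_big_dep xpredT) //=; apply: eq_bigr => j _.
rewrite sumr_const -cards_draws; congr (_ *+ _).
by apply: eq_card => K; rewrite !inE andbC unfold_in /= inE.
Qed.

End Incidence.

(** * From the average over K to the number of ones *)

(** The product is the falling factorial of the real number [a + k], and
    the falling factorial is monotone: the two weights compare in the same
    direction as [d] and [a + k], so the sign of the second factor always makes
    the inequality go the right way. For [d < k] the right side vanishes. *)
Lemma ffact_tangent (R : realDomainType) (a : R) (k d : nat) : 0 <= a ->
  (\prod_(i < k) (a + i.+1%:R)) * (d%:R - (a + k%:R))
    <= (d ^_ k)%:R * (d%:R - (a + k%:R)).
Proof.
move=> a0.
have P0 l : 0 <= \prod_(i < l) (a + i.+1%:R).
  by apply: prodr_ge0 => i _; rewrite addr_ge0.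
have up l e : a + l%:R <= e%:R -> \prod_(i < l) (a + i.+1%:R) <= (e ^_ l)%:R.
  elim: l e => [|l IH] [|e]; rewrite ?big_ord0 ?ffactn0 // big_ord_recr /=.
    by rewrite -natr1; have := ler0n R l; lra.
  rewrite ffactSS natrM => H; rewrite [leRHS]mulrC.
  apply: ler_pM; rewrite ?addr_ge0 ?P0 //.
  by apply: IH; move: H; rewrite -!natr1; lra.
have dn l e : e%:R <= a + l%:R -> (e ^_ l)%:R <= \prod_(i < l) (a + i.+1%:R).
  elim: l e => [|l IH] [|e]; rewrite ?big_ord0 ?ffactn0 //.
  rewrite big_ord_recr /= ffactSS natrM mulrC => H; apply: ler_pM => //.
  by rewrite IH //; move: H; rewrite -!natr1; lra.
have [le|/ltW le] := leP (a + k%:R) d%:R.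
  by rewrite ler_wpM2r ?subr_ge0 ?up.
by rewrite ler_wnM2r ?subr_le0 ?dn.
Qed.

(** The hypothesis on [a] says [a = (s - k - 1)^(1/(t+1)) * m^(t/(t+1))] without
    roots; this [a] is the coefficient of the number of columns in the
    Kovari-Sos-Turan bound for [s - k] rows. *)
Lemma ones_above_threshold (R : realFieldType) (m n s t k : nat) (a : R)
    (A : 'M[bool]_(m, n)) :
    ~~ has_submx A (all_ones s t.+1) -> (k < s)%N -> 0 <= a ->
    a ^+ t.+1 = (s - k).-1%:R * m%:R ^+ t ->
  \prod_(i < k) (a + i.+1%:R) * \sum_j (#|col_supp A j|%:R - (a + k%:R))
    <= t%:R * m%:R ^+ k.+1.
Proof.
move=> noJ ks a0 aE.
have perK (K : {set 'I_m}) : #|K| == k ->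
    \sum_(j in common_cols A K) ((#|col_supp A j| - k)%:R - a) <= t%:R * m%:R.
  move=> /eqP cK.
  rewrite sumrB sumr_const -natr_sum -{1}cK -ones_common_cols.
  have := @kst_common_cols _ _ A s t K noJ; rewrite cK => /(_ ks).
  set x := (\sum_(i in _) _)%N; set y := (\sum_(i in _) _)%N => le_x.
  have yx : (y <= x + t * m)%N.
    (* undoing the truncated subtraction costs at most t for each row *)
    apply: (@leq_trans (x + t * #|~: K|)).
      rewrite mulnC -sum_nat_const -big_split /=.
      by apply: leq_sum => i _; rewrite addnC -leq_subLR.
    rewrite leq_add2l leq_mul2l; apply/orP; right.
    by rewrite -[X in (_ <= X)%N]card_ord max_card.
  have xa : x%:R <= a *+ #|common_cols A K|.
    rewrite -(@ler_pXn2r _ t.+1) ?nnegrE ?mulrn_wge0 //.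
    rewrite -[a *+ _]mulr_natr exprMn aE -!natrX -!natrM ler_nat.
    by apply: leq_trans le_x _; rewrite mulnA [(m ^ t * _)%N]mulnC.
  move: yx; rewrite -(ler_nat R) natrD natrM; lra.
have total : \sum_j (#|col_supp A j| ^_ k)%:R * (#|col_supp A j|%:R - (a + k%:R))
    <= t%:R * m%:R ^+ k.+1.
  have -> : \sum_j (#|col_supp A j| ^_ k)%:R * (#|col_supp A j|%:R - (a + k%:R))
      = k`!%:R * \sum_(K : {set 'I_m} | #|K| == k)
         \sum_(j in common_cols A K) ((#|col_supp A j| - k)%:R - a).
    rewrite sum_common_cols mulr_sumr; apply: eq_bigr => j _.
    rewrite -bin_ffact natrM -mulr_natr.
    (* for d < k the truncated d - k is harmless: its weight is zero *)
    have [dk|kd] := ltnP #|col_supp A j| k; first by rewrite bin_small //; ring.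
    by rewrite natrB //; ring.
  apply: le_trans (_ : k`!%:R * ('C(m, k)%:R * (t%:R * m%:R)) <= _).
    rewrite ler_wpM2l // (le_trans (ler_sum _ perK)) // sumr_const.
    have -> : #|(fun K : {set 'I_m} => #|K| == k)| = 'C(m, k).
      rewrite -[in RHS](card_ord m) -card_draws.
      by apply: eq_card => K; rewrite !inE.
    by rewrite -[leLHS]mulr_natl.
  have := ffact_le_exp m k.
  rewrite -(ler_nat R) -bin_ffact natrM natrX exprSr => le_m.
  rewrite mulrA [k`!%:R * _]mulrC mulrCA ler_wpM2l // ler_wpM2r //.
rewrite mulr_sumr (le_trans _ total) //.
by apply: ler_sum => j _; exact: ffact_tangent.
Qed.

Theorem theorem2 (R : realType) (m n s t : nat)
    (hm : (0 < m)%N) (hn : (0 < n)%N) (hs : (2 <= s)%N) (ht : (2 <= t)%N)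
    (k : nat) (hk : (k <= s - 2)%N) :
  (zarankiewicz m n s t)%:R <=
    (s%:R - k%:R - 1) `^ (1 / t%:R) * n%:R * m%:R `^ (1 - 1 / t%:R)
    + (t%:R - 1) * m%:R `^ (1 + k%:R / t%:R)
    + k%:R * n%:R :> R.
Proof.
case: t ht => [//|t] ht.
have m0 : 0 < m%:R :> R by rewrite ltr0n.
have t0 : t.+1%:R != 0 :> R by rewrite pnatr_eq0.
have sE : s%:R - k%:R - 1 = (s - k).-1%:R :> R.
  by rewrite -subn1 !natrB //; lia.
have tE : t.+1%:R - 1 = t%:R :> R by rewrite -natr1 addrK.
rewrite sE tE.
set b := (m%:R : R) `^ (1 - 1 / t.+1%:R).
set c := ((s - k).-1%:R : R) `^ (1 / t.+1%:R).
have b0 : 0 < b by rewrite powR_gt0.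
have c1 : 1 <= c.
  rewrite -(powRr0 (s - k).-1%:R) ler_powR ?divr_ge0 ?ler1n //; lia.
have ab : b <= c * b by rewrite ler_peMl // ltW.
have aE : (c * b) ^+ t.+1 = (s - k).-1%:R * m%:R ^+ t.
  rewrite exprMn /c /b -!powR_mulrn ?powR_ge0 // -!powRrM div1r mulVf //.
  rewrite powRr1 //; congr (_ * (_ `^ _)).
  by rewrite -natr1 in t0 *; field.
have bE : b ^+ k * m%:R `^ (1 + k%:R / t.+1%:R) = m%:R ^+ k.+1.
  rewrite /b -!powR_mulrn ?powR_ge0 // -powRrM -powRD; last first.
    by apply/implyP => _; rewrite gt_eqF.
  by congr (_ `^ _); rewrite -[k.+1%:R]natr1; field.
rewrite /zarankiewicz.
elim/big_ind: _ => [|x y Hx Hy|A noJ].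
- by rewrite !addr_ge0 // !mulr_ge0 // powR_ge0.
- by rewrite /maxn; case: ifP.
rewrite num_onesE.
have := @ones_above_threshold R m n s t k (c * b) A noJ.
move=> /(_ _ _ aE) -/(_ ltac:(lia) (le_trans (ltW b0) ab)).
set P := \prod_(i < k) _ => main.
have Pb : b ^+ k <= P.
  rewrite -[X in b ^+ X]card_ord -prodr_const; apply: ler_prod => i _.
  by rewrite (ltW b0) (le_trans ab) // lerDl.
have P0 : 0 < P by apply: lt_le_trans Pb; rewrite exprn_gt0.
have : \sum_j (#|col_supp A j|%:R - (c * b + k%:R))
    <= t%:R * m%:R `^ (1 + k%:R / t.+1%:R).
  rewrite -(ler_pM2l P0) (le_trans main) // -bE mulrCA.
  by rewrite ler_wpM2r // mulr_ge0 // powR_ge0.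
rewrite sumrB sumr_const card_ord -natr_sum -mulr_natr.
lra.
Qed.
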